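(* Let $X$ be a non-negative absolutely continuous random variable with probability density function $f$, let $\omega\ge0$ be a weight function and $\beta\ge1$. Suppose $H_k^\omega(X)<\infty$ for all $k$. Then $$I_\beta^\omega(X)=\sum_{k=0}^\infty\frac{(1-\beta)^k}{k!}H_k^\omega(X).$$
   Context: For a non-negative absolutely continuous random variable $X$ with density $f$, a measurable weight $\omega\ge0$ and $\beta\ge1$, the general weighted information generating function (GWIGF) is $I_\beta^\omega(X)=\int_0^\infty \omega(u)f^\beta(u)\,du$. The weighted Shannon entropy of order $k$ is $H_k^\omega(X)=\int_0^\infty\omega(x)(-\log f(x))^k f(x)\,dx$ (natural logarithm). Throughout, all expectations and integrals appearing are assumed to exist.
   Formalization: The formal theorem additionally assumes that the series on the right has a sum (finite or infinite); without this the claim fails, e.g. for X ~ Exp(1), ω = 1, β = 3, where H_k = k!, I = 1/3 and the series Σ(−2)^k has no sum. *)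

(* Defs.v *)
From HB Require Import structures.
From mathcomp Require Import all_boot all_order all_algebra.
From mathcomp Require Import all_classical all_reals all_analysis.

Set Implicit Arguments.
Unset Strict Implicit.
Unset Printing Implicit Defensive.

Import Order.TTheory GRing.Theory Num.Theory.
Import numFieldNormedType.Exports.

Local Open Scope classical_set_scope.
Local Open Scope ring_scope.

Definition is_density (d : measure_display) (T : measurableType d)
    (R : realType) (P : probability T R) (X : {RV P >-> R}) (f : R -> R) : Prop :=
  [/\ measurable_fun [set: R] f,
      (forall x : R, 0 <= f x)
    & (forall A : set R, measurable A ->
        distribution P X A = (\int[lebesgue_measure]_(x in A) (f x)%:E)%E)].

(* Both functionals depend on a random variable only through a density of it,
   so they take the density as argument. *)

Definition gwigf (R : realType) (omega f : R -> R) (beta : R) : \bar R :=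
  (\int[lebesgue_measure]_(x in `[0%R, +oo[) (omega x * f x `^ beta)%:E)%E.

(* [ln 0] is the junk value 0, but the factor [f x] makes the integrand vanish
   where [f] does, which is the usual convention 0 * log 0 = 0. *)
Definition weighted_entropy (R : realType) (omega f : R -> R) (k : nat) : \bar R :=
  (\int[lebesgue_measure]_(x in `[0%R, +oo[)
     (omega x * (- ln (f x)) ^+ k * f x)%:E)%E.

(* Main.v *)
Require Import Defs.
From HB Require Import structures.
From mathcomp Require Import all_boot all_order all_algebra.
From mathcomp Require Import all_classical all_reals all_analysis.
From mathcomp Require Import measurable_realfun ring lra.

(* Write f ^ beta = f exp (s Y) with Y = - ln f and s = 1 - beta, so that the
   partial sums of the series are the integrals of omega f p_n(s Y), where p_n is
   the sum of the first n terms of the exponential series. For even n,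
   p_n <= exp on the whole line, so the even partial sums are at most the
   integral of omega f exp (s Y); for odd n, p_n >= 0, so Fatou's lemma bounds
   that integral by the limit of the odd partial sums. Since the sequence of
   partial sums converges in the extended reals, all three values agree. No
   domination is needed, and an infinite common value is allowed. *)

Set Implicit Arguments.
Unset Strict Implicit.
Unset Printing Implicit Defensive.

Import Order.TTheory GRing.Theory Num.Theory.
Import numFieldNormedType.Exports.

Local Open Scope classical_set_scope.
Local Open Scope ring_scope.

(** As a polynomial it can be differentiated formally and is continuous. [n] counts terms, so for
    even [n > 0] the last power is odd. *)
Definition exp_taylor (R : realType) (n : nat) : {poly R} :=
  \poly_(i < n) (i`!%:R)^-1.

Lemma horner_exp_taylor (R : realType) (n : nat) (x : R) :
  (exp_taylor R n).[x] = series (exp_coeff x) n.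
Proof.
rewrite horner_poly /series /= big_mkord.
by apply: eq_bigr => i _; rewrite mulrC.
Qed.

Lemma deriv_exp_taylor (R : realType) (n : nat) :
  (exp_taylor R n.+1)^`() = exp_taylor R n.
Proof.
apply/polyP => i; rewrite coef_deriv !coef_poly ltnS.
case: ifP => _; last by rewrite mul0rn.
by rewrite -[LHS]mulr_natr factS natrM invfM mulrAC mulVf ?mul1r ?pnatr_eq0.
Qed.

(** Each Taylor remainder is the derivative of the next one. By induction the signed remainder [g]
    has nonpositive derivative on the negative half-line, and it vanishes at 0. *)
Lemma sign_expR_sub_taylor (R : realType) (n : nat) (x : R) :
  x <= 0 -> 0 <= (-1) ^+ n * (expR x - (exp_taylor R n).[x]).
Proof.
elim: n x => [x _|n ih x x0].
  by rewrite expr0 mul1r horner_poly big_ord0 subr0 expR_ge0.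
pose g y := (-1) ^+ n.+1 * (expR y - (exp_taylor R n.+1).[y]) : R.
have dg (y : R) : is_derive y (1 : R) g
    ((-1) ^+ n.+1 * (expR y - (exp_taylor R n).[y])).
  rewrite /g -(deriv_exp_taylor R n); apply: is_deriveZ.
have g0 : g 0 = 0.
  by rewrite /g horner_exp_taylor series_exp_coeff0 expR0 subrr mulr0.
rewrite -/(g x) -g0; apply: (@ler0_derive1_nincrNy _ g 0) => // y.
- rewrite in_itv/= => y0; rewrite derive1E derive_val.
  by rewrite exprS -mulrA mulN1r oppr_le0; apply: ih; exact: ltW.
- apply: continuous_subspaceT => z; apply: differentiable_continuous.
  by apply/derivable1_diffP.
Qed.

(** The sign of the remainder settles [x <= 0]; for [x > 0] all terms are nonnegative and the
    partial sums increase to the exponential. *)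
Lemma exp_taylor_even_le (R : realType) (n : nat) (x : R) :
  ~~ odd n -> (exp_taylor R n).[x] <= expR x.
Proof.
move=> en; case: (leP x 0) => x0.
  have := sign_expR_sub_taylor n x0.
  by rewrite -signr_odd (negbTE en) expr0 mul1r subr_ge0.
rewrite horner_exp_taylor /expR.
apply: nondecreasing_cvgn_le; last exact: is_cvg_series_exp_coeff.
apply/nondecreasing_seqP => m; rewrite [leRHS]seriesSr lerDl.
exact/exp_coeff_ge0/ltW.
Qed.

Lemma exp_taylor_odd_ge0 (R : realType) (n : nat) (x : R) :
  odd n -> 0 <= (exp_taylor R n).[x].
Proof.
move=> on; case: (leP x 0) => x0.
  have := sign_expR_sub_taylor n x0.
  rewrite -signr_odd on expr1 mulN1r opprB subr_ge0.
  exact/le_trans/expR_ge0.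
rewrite horner_exp_taylor /series /=; apply: sumr_ge0 => i _.
exact/exp_coeff_ge0/ltW.
Qed.

(** Integrating the partial sums term by term requires integrable moments. For odd [k] the integrand
    may change sign, and an integral below [+oo] could still be [-oo]. *)
Lemma integrable_moment (d : measure_display) (T : measurableType d)
    (R : realType) (mu : {measure set T -> \bar R}) (D : set T) (w Y : T -> R) :
  measurable D -> measurable_fun D w -> measurable_fun D Y ->
  (forall x, D x -> 0 <= w x) ->
  (forall k, (\int[mu]_(x in D) (w x * Y x ^+ k)%:E < +oo)%E) ->
  forall k, mu.-integrable D (fun x => (w x * Y x ^+ k)%:E).
Proof.
move=> mD mw mY w0 fin k.
have mwY j : measurable_fun D (fun x => (w x * Y x ^+ j)%:E).
  apply/measurable_EFinP; apply: measurable_funM => //.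
  exact: measurable_funX.
have even_ge0 j x : D x -> 0 <= w x * Y x ^+ j.*2.
  by move=> Dx; rewrite mulr_ge0 ?w0// -muln2 exprM sqr_ge0.
have even_int j : mu.-integrable D (fun x => (w x * Y x ^+ j.*2)%:E).
  apply/integrableP; split => //.
  rewrite (eq_integral (fun x => (w x * Y x ^+ j.*2)%:E)) ?fin// => x.
  by rewrite inE => Dx; rewrite gee0_abs// lee_fin even_ge0.
(* [|a| <= 1 + a ^+ 2] with [a = Y x ^+ k]: only even moments, whose integrands
   are nonnegative, are finite by hypothesis. *)
apply: (le_integrable mD (mwY k) _ (integrableD mD (even_int 0%N) (even_int k))).
move=> x Dx; rewrite lee_fin [leRHS]ger0_norm; last first.
  by rewrite addr_ge0// even_ge0.
rewrite normrM (ger0_norm (w0 _ Dx)) expr0 -mulrDr.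
apply: ler_wpM2l; first exact: w0.
rewrite -muln2 exprM -(real_normK (num_real (Y x ^+ k))).
(* The square gives [2 * a <= 1 + a ^+ 2], and [a <= 2 * a] since [a] is nonnegative. *)
set a := `|_|; have : 0 <= (a - 1) ^+ 2 by exact: sqr_ge0.
have : 0 <= a by exact: normr_ge0.
by rewrite expr2; nra.
Qed.

(** This is the moment expansion of the moment generating function of [Y] under the measure with
    density [w] on [D]. *)
Lemma integral_expR_series (d : measure_display) (T : measurableType d)
    (R : realType) (mu : {measure set T -> \bar R}) (D : set T) (w Y : T -> R)
    (s : R) :
  measurable D -> measurable_fun D w -> measurable_fun D Y ->
  (forall x, D x -> 0 <= w x) ->
  (forall k, (\int[mu]_(x in D) (w x * Y x ^+ k)%:E < +oo)%E) ->
  cvgn (fun n => (\sum_(0 <= k < n) (s ^+ k / k`!%:R)%:E *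
    \int[mu]_(x in D) (w x * Y x ^+ k)%:E)%E) ->
  (\int[mu]_(x in D) (w x * expR (s * Y x))%:E =
   \sum_(0 <= k <oo) (s ^+ k / k`!%:R)%:E *
     \int[mu]_(x in D) (w x * Y x ^+ k)%:E)%E.
Proof.
move=> mD mw mY w0 fin.
set S := fun n : nat => _.
move=> cvS.
pose h n x := w x * (exp_taylor R n).[s * Y x].
have msY : measurable_fun D (fun x => s * Y x) by exact: measurable_funM.
have mh n : measurable_fun D (fun x => (h n x)%:E).
  apply/measurable_EFinP; apply: measurable_funM => //.
  apply: (@measurableT_comp _ _ _ _ _ _ (horner (exp_taylor R n))) => //.
  apply: continuous_measurable_fun => x; exact: continuous_horner.
have mg : measurable_fun D (fun x => (w x * expR (s * Y x))%:E).
  apply/measurable_EFinP; apply: measurable_funM => //.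
  exact: measurableT_comp.
have int_mom := integrable_moment mD mw mY w0 fin.
have hE n x : (h n x)%:E = (\sum_(0 <= k < n)
    (s ^+ k / k`!%:R)%:E * (w x * Y x ^+ k)%:E)%E.
  under eq_bigr do rewrite -EFinM.
  rewrite sumEFin; congr EFin.
  rewrite /h horner_exp_taylor /series /= mulr_sumr; apply: eq_bigr => k _.
  by rewrite /exp_coeff /= exprMn; ring.
have int_h n : mu.-integrable D (fun x => (h n x)%:E).
  under eq_fun do rewrite hE.
  by apply: integrable_sum => // k _; exact: integrableZl.
have SE n : S n = (\int[mu]_(x in D) (h n x)%:E)%E.
  rewrite /S; under eq_bigr do rewrite -integralZl//.
  rewrite -integral_sum//; last by move=> k; exact: integrableZl.
  by apply: eq_integral => x _; rewrite hE.
have to_infty (u : nat -> nat) : (forall n, n <= u n)%N -> u @ \oo --> \oo.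
  move=> un A [N _ NA].
  by exists N => // n /= Nn; apply: NA => /=; exact: leq_trans (un n).
have sub_cvg (u : nat -> nat) : (forall n, n <= u n)%N ->
    S \o u @ \oo --> limn S.
  by move=> /to_infty un; exact: cvg_comp cvS.
rewrite -/(limn S); apply/eqP; rewrite eq_le; apply/andP; split.
- pose u n := n.*2.+1.
  have u_ge n : (n <= u n)%N by rewrite /u -addnn -addnS leq_addr.
  have uS := sub_cvg u u_ge.
  (* Fatou's lemma bounds a lower limit, so both the limit of the integrals and the pointwise limit
     are rewritten as lower limits. *)
  rewrite -(cvg_limn_einf_sup uS).1.
  have -> : S \o u = fun n => (\int[mu]_(x in D) (h (u n) x)%:E)%E.
    by apply/funext => n /=; rewrite SE.
  apply: le_trans (fatou mu mD (fun n => mh (u n)) _).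
    rewrite le_eqVlt; apply/orP; left; apply/eqP; apply: eq_integral => x _.
    symmetry; apply: (cvg_limn_einf_sup _).1.
    apply: cvg_EFin; first by apply: nearW.
    apply: cvgMr.
    under eq_fun do rewrite horner_exp_taylor.
    apply: (cvg_comp _ _ (to_infty u u_ge)).
    exact: is_cvg_series_exp_coeff.
  move=> n x Dx; rewrite lee_fin mulr_ge0 ?w0//.
  by rewrite exp_taylor_odd_ge0//= odd_double.
- have uS : S \o double @ \oo --> limn S.
    by apply: sub_cvg => n; rewrite -addnn leq_addr.
  rewrite -(cvg_lim _ uS)//; apply: lime_le.
    by apply/cvg_ex; exists (limn S).
  apply: nearW => n /=; rewrite SE.
  (* The even partial sums may be negative, so monotonicity of the integral is applied to integrable
     functions; an infinite right-hand side is trivial. *)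
  have [->|g_fin] :=
    eqVneq (\int[mu]_(x in D) (w x * expR (s * Y x))%:E)%E +oo%E.
    exact: leey.
  apply: le_integral => //.
    apply/integrableP; split => //.
    rewrite (eq_integral (fun x => (w x * expR (s * Y x))%:E)) ?ltey// => x.
    by rewrite inE => Dx; rewrite gee0_abs// lee_fin mulr_ge0 ?w0 ?expR_ge0.
  move=> x /[!inE] Dx; rewrite lee_fin; apply: ler_wpM2l; first exact: w0.
  by apply: exp_taylor_even_le; rewrite odd_double.
Qed.

Lemma mul_expR_ln (R : realType) (a b : R) :
  0 <= a -> 1 <= b -> a * expR ((b - 1) * ln a) = a `^ b.
Proof.
(* At [a = 0] the factor [a] cancels the junk value of [ln 0], and [1 <= b] excludes the convention
   that 0 to the power 0 is 1. *)
rewrite le_eqVlt => /predU1P[<- b1|a0 _].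
  by rewrite mul0r powR0// gt_eqF// (lt_le_trans ltr01).
rewrite /powR gt_eqF// -[X in X * _](lnK a0) -expRD; congr expR; ring.
Qed.

Theorem proposition2p2 (R : realType) (d : measure_display)
    (T : measurableType d) (P : probability T R) (X : {RV P >-> R})
    (f omega : R -> R) (beta : R)
    (hX : {ae P, forall t, 0 <= X t})
    (hf : is_density X f)
    (homega_meas : measurable_fun (`[0%R, +oo[%classic : set R) omega)
    (homega_ge0 : forall x : R, 0 <= x -> 0 <= omega x)
    (hbeta : 1 <= beta)
    (hH : forall k : nat, (weighted_entropy omega f k < +oo)%E)
    (hsum : cvgn (fun n : nat =>
      (\sum_(0 <= k < n)
         ((1 - beta) ^+ k / k`!%:R)%:E * weighted_entropy omega f k)%E)) :
  gwigf omega f beta =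
    (\sum_(0 <= k <oo)
       ((1 - beta) ^+ k / k`!%:R)%:E * weighted_entropy omega f k)%E.
Proof.
have [mf f0 _] := hf.
have mD : measurable (`[0%R, +oo[%classic : set R) by exact: measurable_itv.
have mY : measurable_fun (`[0%R, +oo[%classic : set R) (fun x => - ln (f x)).
  apply: measurable_funTS; apply: (@measurable_funN _ _ _ _ (fun x => ln (f x))).
  exact: measurableT_comp.
have mw : measurable_fun (`[0%R, +oo[%classic : set R) (fun x => omega x * f x).
  by apply: measurable_funM => //; exact: measurable_funTS.
(* The density joins the weight, so that the entropies become the moments of [- ln f]. *)
have entE k : weighted_entropy omega f k =
    (\int[lebesgue_measure]_(x in `[0%R, +oo[)
      (omega x * f x * (- ln (f x)) ^+ k)%:E)%E.
  by apply: eq_integral => x _; rewrite mulrAC.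
have -> : gwigf omega f beta =
    (\int[lebesgue_measure]_(x in `[0%R, +oo[)
      (omega x * f x * expR ((1 - beta) * - ln (f x)))%:E)%E.
  apply: eq_integral => x _.
  by rewrite mulrN -mulNr opprB -mulrA mul_expR_ln.
under [RHS]eq_eseriesr do rewrite entE.
apply: (@integral_expR_series _ _ R (@lebesgue_measure R) _
  (fun x => omega x * f x) (fun x => - ln (f x)) (1 - beta) mD mw mY).
- by move=> x /=; rewrite in_itv/= andbT => x0; rewrite mulr_ge0 ?homega_ge0.
- by move=> k; rewrite -entE.
- by under eq_fun do under eq_bigr do rewrite -entE.
Qed.
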